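(* There is an absolute constant $C$ such that for every integer $n > C$, \[ \mu_5(n) \geq \frac{5\sqrt{5}-11}{480}\, n^5, \] and consequently \[ c_5 := \lim_{n\to\infty} \frac{\mu_5(n)}{\binom{n}{5}} \geq \frac{5\sqrt{5}-11}{4}. \]
   Context: A point placement is a finite set $P \subset \mathbb{R}^2$ with no three points collinear. For $n \ge 5$, $\mu_5(n)$ denotes the minimum, over all point placements $P$ with $|P| = n$, of the number of $5$-element subsets of $P$ whose points are in convex position (i.e., form a convex pentagon). The limit $c_5$ is known to exist. *)

(* Defs.v *)
From mathcomp Require Import all_boot all_order all_algebra finmap.
From mathcomp Require Import all_classical all_reals all_analysis.
From mathcomp Require Import ring.

Set Implicit Arguments.
Unset Strict Implicit.
Unset Printing Implicit Defensive.

Import Order.TTheory GRing.Theory Num.Theory.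
Import numFieldNormedType.Exports.

Local Open Scope classical_set_scope.
Local Open Scope ring_scope.

Section Definitions.
Variable R : realType.
Local Notation point := 'rV[R]_2.

Definition line (o v : point) : set point := [set o + t *: v | t in [set: R]].

Definition collinear (A : set point) : Prop :=
  exists o v : point, v != 0 /\ A `<=` line o v.

Definition point_placement (P : {fset point}) : Prop :=
  forall T : {fset point}, (T `<=` P)%fset -> #|` T| = 3%N -> ~ collinear [set` T].

Definition convex_hull (A : set point) : set point :=
  smallest (@convex_set R point) A.

Definition convex_position (Q : {fset point}) : Prop :=
  forall p : point, p \in Q -> ~ convex_hull [set` (Q `\ p)%fset] p.

Definition convex_pentagons (P : {fset point}) : nat :=
  #|` [fset Q in fpowerset P | (#|` Q| == 5%N) && `[< convex_position Q >]]%fset|.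

Definition pentagon_count (n m : nat) : Prop :=
  exists P : {fset point},
    [/\ point_placement P, #|` P| = n & convex_pentagons P = m].

(* Points of the parabola y = x ^ 2, used only to see that the minimum below
   ranges over a nonempty set. *)
Definition parabola (k : nat) : point := \row_(j < 2) k%:R ^+ j.+1.

Lemma parabola_inj : injective parabola.
Proof.
move=> i j /rowP /(_ ord0); rewrite !mxE !expr1 => /eqP.
by rewrite eqr_nat => /eqP.
Qed.

Lemma parabola_lineF (o v : point) (a b c : nat) : a != b -> b != c -> a != c ->
  v != 0 -> line o v (parabola a) -> line o v (parabola b) ->
  line o v (parabola c) -> False.
Proof.
move=> ab bc ac v0 [s _ Es] [t _ Et] [u _ Eu].
set i0 : 'I_2 := ord0; set i1 : 'I_2 := lift ord0 ord0.
have E k r : o + r *: v = parabola k ->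
    k%:R = o 0 i0 + r * v 0 i0 /\ k%:R ^+ 2 = o 0 i1 + r * v 0 i1.
  by move=> /rowP Ek; split; [have := Ek i0|have := Ek i1]; rewrite !mxE.
have [a1 a2] := E _ _ Es; have [b1 b2] := E _ _ Et; have [c1 c2] := E _ _ Eu.
have : (a%:R - b%:R) * (b%:R - c%:R) * (a%:R - c%:R) = 0 :> R.
  have -> : (a%:R - b%:R) * (b%:R - c%:R) * (a%:R - c%:R) =
    a%:R ^+ 2 * (b%:R - c%:R) + b%:R ^+ 2 * (c%:R - a%:R)
    + c%:R ^+ 2 * (a%:R - b%:R) :> R by ring.
  by rewrite a2 b2 c2 a1 b1 c1; ring.
by move/eqP; rewrite !mulf_eq0 !subr_eq0 !eqr_nat (negbTE ab) (negbTE bc)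
  (negbTE ac).
Qed.

Lemma exists_pentagon_count (n : nat) :
  exists m, (fun m => `[< pentagon_count n m >]) m.
Proof.
pose P : {fset point} := [fset parabola i | i in iota 0 n]%fset.
exists (convex_pentagons P); apply/asboolP; exists P; split => //; last first.
  by rewrite (card_imfset _ _ parabola_inj) /= undup_id ?iota_uniq // size_iota.
move=> T /fsubsetP TP T3 [] o [v [v0 Tov]].
have : uniq T by exact: fset_uniq.
have {}TP (x : point) :
    x \in (T : seq point) -> exists k, x = parabola k /\ line o v x.
  move=> xT; have /imfsetP[k _ Ek] := TP _ xT.
  by exists k; split => //; exact: Tov.
have {T3} : size (T : seq point) = 3%N by [].
case: (T : seq point) TP => [|x [|y [|z [|w s]]]] //= TP _.
have memx : x \in [:: x; y; z] by rewrite !inE eqxx.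
have memy : y \in [:: x; y; z] by rewrite !inE eqxx orbT.
have memz : z \in [:: x; y; z] by rewrite !inE eqxx !orbT.
have [a [Ea La]] := TP x memx.
have [b [Eb Lb]] := TP y memy.
have [c [Ec Lc]] := TP z memz.
rewrite !inE negb_or !andbT Ea Eb Ec !(inj_eq parabola_inj).
move=> /andP[/andP[ab ac] bc].
rewrite {}Ea in La; rewrite {}Eb in Lb; rewrite {}Ec in Lc.
exact: (parabola_lineF ab bc ac v0 La Lb Lc).
Qed.

Definition mu5 (n : nat) : nat := ex_minn (exists_pentagon_count n).

(* For n < 5 this is 0 / 0 = 0, which does not affect the limit. *)
Definition pentagon_density (n : nat) : R := (mu5 n)%:R / 'C(n, 5)%:R.

Definition c5 : R := limn pentagon_density.

End Definitions.

(* Main.v *)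
(** For an ordered quadruple of points whose orientations follow one of two
    prescribed patterns (a triangle with an interior point, or a convex
    quadrilateral), every further point [q] lies in some cell of the six lines
    spanned by the quadruple; giving weights to the cells, the square of the
    total weight of all [q] is nonnegative. Summing suitable multiples of five
    such squares over all quadruples and regrouping the terms by 6-point subsets
    bounds the number of convex pentagons from below, up to O(n^4), provided one
    linear inequality holds for each configuration of six points. Labelling the
    six points by a hull vertex followed by the other five in angular order
    leaves 62 sign patterns, which are checked by computation. The weights come
    from a semidefinite program; the resulting density 24 * 525 / 276000
    exceeds (5 sqrt 5 - 11) / 4 strictly, and this slack absorbs the O(n^4). *)

From Stdlib Require Import ZArith.
Require Import Defs.
From mathcomp Require Import all_boot all_order all_algebra.
From mathcomp Require Import finmap perm ssrZ zify ring lra.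
From mathcomp Require Import all_classical all_reals all_analysis.

Set Implicit Arguments.
Unset Strict Implicit.
Unset Printing Implicit Defensive.

Import Order.TTheory GRing.Theory Num.Theory.
Import numFieldNormedType.Exports.
Local Open Scope classical_set_scope.
Local Open Scope ring_scope.

(** * The certificate *)

Fixpoint weighted_dot (l u v : seq Z) : Z :=
  match l, u, v with
  | x :: l', y :: u', z :: v' =>
      x * (y * z) + weighted_dot l' u' v'
  | _, _, _ => 0
  end.

(** A missing key yields the empty list, which [weighted_dot] treats as the zero vector. *)
Fixpoint cell_lookup (t : seq (seq bool * seq Z)) (k : seq bool) : seq Z :=
  if t is e :: t' then if e.1 == k then e.2 else cell_lookup t' k else [::].

Section Certificate.
Open Scope Z_scope.
Local Notation T := true.
Local Notation F := false.

(* A cell is keyed by the orientations of [abq], [acq], [adq], [bcq], [bdq],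
   [cdq] relative to that of [abc] (see [cell]); unlisted keys are not
   realizable. Each cell carries one weight per square. In the nested pattern
   [c] is the point inside the triangle [abd]. *)
Definition nested_table : seq (seq bool * seq Z) :=
  [:: ([:: T; T; T; F; F; F], [:: -14; 15; 13]);
      ([:: T; T; F; F; T; T], [:: -12; 0; -13]);
      ([:: T; F; F; T; T; F], [:: -15; 0; -13]);
      ([:: F; F; F; F; F; F], [:: -11; 15; 3]);
      ([:: T; T; T; F; F; T], [:: 14; 15; -13]);
      ([:: T; T; F; F; T; F], [:: 12; 0; 13]);
      ([:: T; F; F; T; T; T], [:: 15; 0; 13]);
      ([:: F; F; F; T; F; F], [:: 3; 15; -12]);
      ([:: T; F; F; F; T; F], [:: -3; 0; 3]);
      ([:: T; T; F; T; T; T], [:: 3; 0; -3]);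
      ([:: F; T; T; T; T; T], [:: 11; 15; -3]);
      ([:: F; F; T; T; T; T], [:: -3; 15; 12]);
      ([:: F; F; F; T; T; T], [:: 12; -13; -14]);
      ([:: T; T; T; T; T; T], [:: 13; -13; 0]);
      ([:: F; F; F; T; T; F], [:: -12; -13; 14]);
      ([:: T; F; F; F; F; F], [:: -13; -13; 0]);
      ([:: T; T; T; F; T; T], [:: 0; -13; 15]);
      ([:: T; T; F; F; F; F], [:: 0; -13; -15])].

Definition convex_table : seq (seq bool * seq Z) :=
  [:: ([:: F; F; F; F; F; F], [:: -11; 0]);
      ([:: T; T; T; T; T; T], [:: 15; 1]);
      ([:: T; T; F; T; F; F], [:: 15; 2]);
      ([:: T; F; F; F; F; T], [:: 15; -1]);
      ([:: F; F; F; T; T; T], [:: 15; -2]);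
      ([:: T; T; T; F; F; F], [:: -11; -2]);
      ([:: F; T; T; T; T; F], [:: -11; 0]);
      ([:: F; F; T; F; T; T], [:: -11; 2]);
      ([:: T; T; T; T; T; F], [:: 0; -12]);
      ([:: T; T; F; T; F; T], [:: 5; -10]);
      ([:: T; F; F; F; F; F], [:: 0; -15]);
      ([:: F; F; F; F; T; T], [:: 0; 7]);
      ([:: T; F; F; T; F; T], [:: 5; 7]);
      ([:: T; T; F; F; F; F], [:: 0; 12]);
      ([:: T; T; T; T; F; F], [:: 0; -7]);
      ([:: T; T; F; T; T; T], [:: 5; -7]);
      ([:: F; F; F; F; F; T], [:: 0; 12]);
      ([:: T; F; F; T; T; T], [:: 5; 10]);
      ([:: F; F; T; T; T; T], [:: 0; -12]);
      ([:: F; T; T; T; T; T], [:: 0; 15])].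

Definition nested_multipliers : seq Z := [:: 190; 38; 8].
Definition convex_multipliers : seq Z := [:: 146; 145].
Definition pentagon_multiplier : Z := 276000.
Definition density_numerator : Z := 525.

End Certificate.

(** * Squares, pentagons and sign patterns as functions of orientations *)

Section SignFunctions.
Context {T : Type}.
Implicit Types (chi : T -> T -> T -> bool) (a b c d e q : T).

Definition cell chi a b c d q : seq bool :=
  let s := chi a b c in
  [:: s == chi a b q; s == chi a c q; s == chi a d q;
      s == chi b c q; s == chi b d q; s == chi c d q].

Definition square_term chi a b c d q q' : Z :=
  let s := chi a b c in
  if (s == chi a b d) && (s == chi a c d) then
    if s == chi b c d then
      weighted_dot convex_multipliers
        (cell_lookup convex_table (cell chi a b c d q))
        (cell_lookup convex_table (cell chi a b c d q'))
    else
      weighted_dot nested_multipliers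
        (cell_lookup nested_table (cell chi a b c d q))
        (cell_lookup nested_table (cell chi a b c d q'))
  else 0.

Definition ccw5 chi a b c d e : bool :=
  [&& chi a b c, chi a b d, chi a b e, chi a c d, chi a c e, chi a d e,
      chi b c d, chi b c e, chi b d e & chi c d e].

(** The share of one ordered 6-tuple in the linear inequality: entries one to five are tested as a
    pentagon, entries one to four span the lines of a square, and the last two index its factors.
    The sign is controlled only after summing over all 720 orderings. *)
Definition balance chi (t : seq T) : Z :=
  if t is [:: a; b; c; d; e; q] then
    (if ccw5 chi a b c d e then pentagon_multiplier else 0) -
    (square_term chi a b c d e q + density_numerator)
  else 0.

End SignFunctions.

(* Orientation of the labels [i < j < k] of six points, where label 0 is a hull
   vertex around which 1, ..., 5 are sorted counterclockwise; [s] lists the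
   orientations of the triples of 1, ..., 5 in colexicographic order. *)
Definition orient_sorted (s : seq bool) (i j k : nat) : bool :=
  (i == 0)%N || nth false s ('C(k.-1, 3) + 'C(j.-1, 2) + i.-1).

Definition orient (s : seq bool) (i j k : nat) : bool :=
  if (i < j)%N then
    if (j < k)%N then orient_sorted s i j k
    else if (i < k)%N then (k < j)%N && ~~ orient_sorted s i k j
    else (k < i)%N && orient_sorted s k i j
  else if (j < i)%N then
    if (i < k)%N then ~~ orient_sorted s j i k
    else if (j < k)%N then (k < i)%N && orient_sorted s j k i
    else (k < j)%N && ~~ orient_sorted s k j i
  else false.

Definition at_most_one_change (u : seq bool) : bool :=
  sorted implb u || sorted (fun x y => implb y x) u.

(** Quadruples containing label 0 satisfy the axiom by themselves: their first three signs are all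
    [true]. *)
Definition signotope5 (s : seq bool) : bool :=
  all (fun q => if q is [:: i; j; k; l] then
      at_most_one_change [:: orient s i j k; orient s i j l;
                             orient s i k l; orient s j k l] else true)
    [:: [:: 1; 2; 3; 4]; [:: 1; 2; 3; 5]; [:: 1; 2; 4; 5];
        [:: 1; 3; 4; 5]; [:: 2; 3; 4; 5]]%N.

Fixpoint bitseqs (n : nat) : seq bitseq :=
  if n is n'.+1 then
    map (cons true) (bitseqs n') ++ map (cons false) (bitseqs n')
  else [:: [::]].

Lemma mem_bitseqs (s : bitseq) : s \in bitseqs (size s).
Proof.
elim: s => // b s IH; rewrite /= mem_cat; apply/orP.
by case: b; [left|right]; apply: map_f.
Qed.

(** A plain fold, so that [vm_compute] can evaluate it. *)
Definition total_balance (s : seq bool) : Z :=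
  foldr (fun t acc => balance (orient s) t + acc) 0 (permutations (iota 0 6)).

Lemma certificate_check :
  all (fun s => 0 <= total_balance s) [seq s <- bitseqs 10 | signotope5 s].
Proof. by vm_compute. Qed.

(** * From the certificate to a count of pentagons *)

Section TupleSums.
Variables (T : finType).

Lemma sum_tupleS {n} (F : seq T -> Z) :
  \sum_(t : n.+1.-tuple T) F t = \sum_(x : T) \sum_(t : n.-tuple T) F (x :: t).
Proof.
rewrite pair_big /=.
rewrite (reindex (fun p : T * n.-tuple T => [tuple of p.1 :: p.2])) //=.
exists (fun t : n.+1.-tuple T => (thead t, [tuple of behead t])) =>
  [[x t]|t] _ /=.
  by congr pair; apply: val_inj.
by rewrite -tuple_eta.
Qed.

Lemma sum_tuple0 (F : seq T -> Z) : \sum_(t : 0.-tuple T) F t = F [::].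
Proof.
by rewrite (big_pred1 [tuple]) // => t /=; apply/esym/eqP; exact: tuple0.
Qed.

Lemma weighted_dot0l l v : weighted_dot l [::] v = 0.
Proof. by case: l. Qed.

Lemma weighted_dot0r l u : weighted_dot l u [::] = 0.
Proof. by case: l => //; case: u. Qed.

(** Coordinate by coordinate, the double sum is a multiplier times the square of a single sum. *)
Lemma sum_weighted_dot_ge0 (l : seq Z) (u : T -> seq Z) :
  all (fun x => 0 <= x) l ->
  0 <= \sum_x \sum_y weighted_dot l (u x) (u y).
Proof.
elim: l u => [|a l IH] u.
  by move=> _; rewrite big1 // => x _; rewrite big1.
move=> /andP[a0 l0].
have E x y : weighted_dot (a :: l) (u x) (u y) =
    a * (head 0 (u x) * head 0 (u y)) +
    weighted_dot l (behead (u x)) (behead (u y)).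
  case: (u x) => [|? ?]; case: (u y) => [|? ?] //=;
    by rewrite ?weighted_dot0l ?weighted_dot0r ?mul0r ?mulr0 ?addr0.
under eq_bigr => x _ do (under eq_bigr => y _ do rewrite E).
under eq_bigr => x _ do rewrite big_split /=.
rewrite big_split /= addr_ge0 ?IH //.
under eq_bigr => x _ do rewrite -mulr_sumr -mulr_sumr.
rewrite -mulr_sumr -mulr_suml mulr_ge0 //.
by rewrite -expr2 sqr_ge0.
Qed.

Arguments weighted_dot : simpl never.
Arguments cell_lookup : simpl never.

Lemma sum_tuple6 (F : seq T -> Z) :
  \sum_(t : 6.-tuple T) F t =
  \sum_a \sum_b \sum_c \sum_d \sum_p \sum_q F [:: a; b; c; d; p; q].
Proof.
rewrite (sum_tupleS F); apply: eq_bigr => a _.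
rewrite (sum_tupleS (fun t => F (a :: t))); apply: eq_bigr => b _.
rewrite (sum_tupleS (fun t => F [:: a, b & t])); apply: eq_bigr => c _.
rewrite (sum_tupleS (fun t => F [:: a, b, c & t])); apply: eq_bigr => d _.
rewrite (sum_tupleS (fun t => F [:: a, b, c, d & t])); apply: eq_bigr => p _.
rewrite (sum_tupleS (fun t => F [:: a, b, c, d, p & t])).
apply: eq_bigr => q _.
by rewrite (sum_tuple0 (fun t => F [:: a, b, c, d, p, q & t])).
Qed.

Definition tuple_square chi (t : seq T) : Z :=
  if t is [:: a; b; c; d; p; q] then square_term chi a b c d p q else 0.

(** For fixed [a b c d] the sum is a combination of squares only if [p] and [q] range independently
    over all of [T], so tuples with repetitions are included. *)
Lemma sum_tuple_square_ge0 (chi : T -> T -> T -> bool) :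
  0 <= \sum_(t : 6.-tuple T) tuple_square chi t.
Proof.
rewrite sum_tuple6 /=.
apply: sumr_ge0 => a _; apply: sumr_ge0 => b _.
apply: sumr_ge0 => c _; apply: sumr_ge0 => d _; rewrite /square_term /=.
case: (_ && _); last by rewrite big1 // => p _; rewrite big1.
case: (_ == chi b c d).
- exact: (sum_weighted_dot_ge0
    (fun q => cell_lookup convex_table (cell chi a b c d q))).
- exact: (sum_weighted_dot_ge0
    (fun q => cell_lookup nested_table (cell chi a b c d q))).
Qed.

Definition permute_tuple n (p : 'S_n) (t : n.-tuple T) : n.-tuple T :=
  [tuple tnth t (p i) | i < n].

Lemma permute_tupleM n (p q : 'S_n) (t : n.-tuple T) :
  permute_tuple p (permute_tuple q t) = permute_tuple (p * q)%g t.
Proof. by apply: eq_from_tnth => i; rewrite !tnth_mktuple permM. Qed.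

Lemma permute_tuple1 n (t : n.-tuple T) : permute_tuple 1%g t = t.
Proof. by apply: eq_from_tnth => i; rewrite tnth_mktuple perm1. Qed.

Lemma permute_tuple_inj n (p : 'S_n) : injective (permute_tuple p).
Proof.
by apply: (@can_inj _ _ _ (permute_tuple p^-1)) => t;
  rewrite permute_tupleM mulVg permute_tuple1.
Qed.

Lemma permute_tuple_uniq n (p : 'S_n) (t : n.-tuple T) :
  uniq (permute_tuple p t) = uniq t.
Proof. by apply: perm_uniq; apply/tuple_permP; exists p. Qed.

End TupleSums.

Lemma balance_map (T U : Type) (f : U -> T) (chi : T -> T -> T -> bool) t :
  balance chi (map f t) = balance (fun x y z => chi (f x) (f y) (f z)) t.
Proof. by case: t => [|? [|? [|? [|? [|? [|? [|? ?]]]]]]]. Qed.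

(** Links the group used for symmetrization to the explicit list on which the certificate is
    evaluated. *)
Lemma sum_perm_permutations n (F : seq nat -> Z) :
  \sum_(p : 'S_n) F [seq val (p i) | i <- enum 'I_n] =
  \sum_(t <- permutations (iota 0 n)) F t.
Proof.
pose code (p : 'S_n) := [seq val (p i) | i <- enum 'I_n].
have code_inj : injective code.
  move=> p q /eq_in_map E; apply/permP => i; apply: val_inj.
  by apply: E; rewrite mem_enum.
rewrite -(big_map code predT F); apply: perm_big; apply: uniq_perm.
- by rewrite map_inj_uniq // /index_enum -enumT enum_uniq.
- exact: permutations_uniq.
move=> t; rewrite mem_permutations; apply/mapP/idP => [[p _ ->]|].
  rewrite /code map_comp -val_enum_ord; apply: perm_map; apply: uniq_perm.
  - by rewrite map_inj_uniq ?enum_uniq //; exact: perm_inj.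
  - exact: enum_uniq.
  move=> i; rewrite mem_enum inE; apply/mapP; exists (p^-1%g i) => //.
    by rewrite mem_enum.
  by rewrite permKV.
move=> tP; have st : size t == n by rewrite (perm_size tP) size_iota.
have := tP; rewrite -val_enum_ord => tP'.
have /tuple_permP[p Ep] : perm_eq t [tuple val i | i < n].
  exact: tP'.
exists p; first by rewrite /index_enum -enumT mem_enum.
by rewrite Ep /code; apply: eq_map => i; rewrite tnth_mktuple.
Qed.

Lemma total_balanceE s :
  total_balance s = \sum_(t <- permutations (iota 0 6)) balance (orient s) t.
Proof. by rewrite /total_balance unlock; elim: permutations => //= t l ->. Qed.

Definition sign_pattern_condition (T : eqType) (chi : T -> T -> T -> bool) :=
  forall t : 6.-tuple T, uniq t -> exists (p : 'S_6) (s : seq bool),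
    [/\ size s = 10%N, signotope5 s & forall i j k : 'I_6,
      chi (tnth t (p i)) (tnth t (p j)) (tnth t (p k)) = orient s i j k].

Section Counting.
Variables (T : finType) (chi : T -> T -> T -> bool).
Hypothesis chiP : sign_pattern_condition chi.

(** Summing over all of ['S_6] makes the labelling irrelevant, so the labelling [q] with signotope
    signs may be chosen; there the sum is [total_balance s]. *)
Lemma sum_balance_permute_ge0 (t : 6.-tuple T) : uniq t ->
  0 <= \sum_(p : 'S_6) balance chi (permute_tuple p t).
Proof.
move=> /chiP [q [s [ss sig Es]]].
rewrite (reindex_inj (mulIg q)) /=.
have -> : \sum_(p : 'S_6) balance chi (permute_tuple (p * q)%g t) =
    total_balance s; last first.
  have /allP/(_ s) := certificate_check; apply.
  by rewrite mem_filter sig; have := mem_bitseqs s; rewrite ss.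
rewrite total_balanceE -sum_perm_permutations; apply: eq_bigr => p _.
have -> : tval (permute_tuple (p * q)%g t) =
    [seq tnth t (q i) | i <- [seq p i | i <- enum 'I_6]].
  by rewrite -map_comp; apply: eq_map => i /=; rewrite permM.
rewrite (map_comp val p) !balance_map; congr (balance _ _).
by apply/funext => i; apply/funext => j; apply/funext => k; rewrite Es.
Qed.

(** Each permutation maps the duplicate-free tuples bijectively onto themselves, so 720 copies of
    the sum regroup into orbit sums. *)
Lemma sum_balance_ge0 : 0 <= \sum_(t : 6.-tuple T | uniq t) balance chi t.
Proof.
have -> // : (0 <= \sum_(t : 6.-tuple T | uniq t) balance chi t) =
    (0 <= \sum_(p : 'S_6) \sum_(t : 6.-tuple T | uniq t) balance chi t).
  by rewrite sumr_const pmulrn_lge0 //; apply/card_gt0P; exists 1%g.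
rewrite (eq_bigr (fun p => \sum_(t : 6.-tuple T | uniq t)
    balance chi (permute_tuple p t))); last first.
  move=> p _; rewrite (reindex_inj (@permute_tuple_inj _ _ p)) /=.
  by apply: eq_bigl => t; rewrite permute_tuple_uniq.
by rewrite exchange_big sumr_ge0 // => t; apply: sum_balance_permute_ge0.
Qed.

End Counting.

(** * Bounding the cost of tuples with repetitions *)

Lemma cell_lookup_bounded (t : seq (seq bool * seq Z)) (B : Z) k :
  all (fun e => all (fun x => `|x| <= B) e.2) t ->
  all (fun x => `|x| <= B) (cell_lookup t k).
Proof. by elim: t => //= e t IH /andP[He /IH]; case: eqP. Qed.

Lemma weighted_dot_bounded (l u v : seq Z) (B : Z) :
  all (fun x => 0 <= x) l -> all (fun x => `|x| <= B) u ->
  all (fun x => `|x| <= B) v ->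
  weighted_dot l u v <= B ^+ 2 * \sum_(x <- l) x.
Proof.
elim: l u v => [|x l IH] u v; first by rewrite big_nil mulr0.
move=> /andP[x0 l0]; rewrite big_cons mulrDr.
have s0 : 0 <= \sum_(y <- l) y by rewrite big_seq sumr_ge0 // => y /(allP l0).
have B0 : 0 <= B ^+ 2 by rewrite sqr_ge0.
have rhs0 : 0 <= B ^+ 2 * x + B ^+ 2 * (\sum_(y <- l) y).
  by apply: addr_ge0; apply: mulr_ge0.
case: u => [_ _|y u /andP[yB uB]]; first by rewrite weighted_dot0l.
case: v => [_|z v /andP[zB vB]]; first by rewrite weighted_dot0r.
rewrite /weighted_dot -/weighted_dot; apply: lerD; last exact: IH.
rewrite [leRHS]mulrC; apply: ler_wpM2l => //.
by rewrite (le_trans (ler_norm _)) // normrM expr2 ler_pM.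
Qed.

(** Weights are at most 15 in absolute value, and 291 = 146 + 145 is the larger of the two totals of
    multipliers. *)
Definition square_bound : Z := Z.of_nat 225 * Z.of_nat 291.

Lemma square_term_bounded (T : Type) (chi : T -> T -> T -> bool) a b c d p q :
  square_term chi a b c d p q <= square_bound.
Proof.
have B k (t := cell_lookup nested_table k) (t' := cell_lookup convex_table k) :
    all (fun x => `|x| <= Z.of_nat 15) t /\
    all (fun x => `|x| <= Z.of_nat 15) t'.
  by split; apply: cell_lookup_bounded; vm_compute.
rewrite /square_term; cbv zeta; case: (_ && _) => //; case: (_ == _).
- apply: le_trans (weighted_dot_bounded _ (B _).2 (B _).2) _ => //.
  by rewrite unlock.
- apply: le_trans (weighted_dot_bounded _ (B _).1 (B _).1) _ => //.
  by rewrite unlock.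
Qed.

Section CountingBound.
Variables (T : finType) (chi : T -> T -> T -> bool).
Hypothesis chiP : sign_pattern_condition chi.

Definition tuple_ccw (t : seq T) : bool :=
  if t is [:: a; b; c; d; e] then ccw5 chi a b c d e else false.

(** The sixth entry is free, even to repeat another one, hence the factor [#|T|]. *)
Lemma sum_tuple_ccw :
  \sum_(t : 6.-tuple T)
    (if tuple_ccw (take 5 t) then pentagon_multiplier else 0) =
  pentagon_multiplier * #|T|%:R * #|[pred t : 5.-tuple T | tuple_ccw t]|%:R.
Proof.
rewrite (sum_tuple6 (fun t => if tuple_ccw (take 5 t) then _ else 0)) /=.
pose F (t : seq T) : Z :=
  if tuple_ccw t then pentagon_multiplier * #|T|%:R else 0.
transitivity (\sum_(t : 5.-tuple T) F t); last first.
  rewrite /F -big_mkcond /= sumr_const -[LHS]mulr_natr; congr (_ * _%:R).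
rewrite (sum_tupleS F); apply: eq_bigr => a _.
rewrite (sum_tupleS (fun t => F (a :: t))); apply: eq_bigr => b _.
rewrite (sum_tupleS (fun t => F [:: a, b & t])); apply: eq_bigr => c _.
rewrite (sum_tupleS (fun t => F [:: a, b, c & t])); apply: eq_bigr => d _.
rewrite (sum_tupleS (fun t => F [:: a, b, c, d & t])); apply: eq_bigr => e _.
rewrite (sum_tuple0 (fun t => F [:: a, b, c, d, e & t])).
by rewrite sumr_const /F /=; case: ifP => _; rewrite ?mul0rn // mulr_natr.
Qed.

(** The balance is summed over duplicate-free tuples, but the squares are known to be nonnegative
    only over all tuples; each of the [#|T| ^ 6 - #|T| ^_ 6] others costs at most [square_bound]. *)
Lemma ccw_count_lower_bound :
  (density_numerator + square_bound) * (#|T| ^_ 6)%:R <=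
  pentagon_multiplier * #|T|%:R * #|[pred t : 5.-tuple T | tuple_ccw t]|%:R
  + square_bound * #|T|%:R ^+ 6.
Proof.
have card_uniq : \sum_(t : 6.-tuple T | uniq t) (1 : Z) = (#|T| ^_ 6)%:R.
  rewrite sumr_const; congr _%:R; rewrite -card_uniq_tuples.
  by apply: eq_card => t; rewrite !inE /= all_predT.
have card_all : \sum_(t : 6.-tuple T) (1 : Z) = #|T|%:R ^+ 6.
  by rewrite sumr_const card_tuple natrX.
have E (t : 6.-tuple T) : balance chi t =
    (if tuple_ccw (take 5 t) then pentagon_multiplier else 0)
    - tuple_square chi t - density_numerator * 1.
  case: t => -[|a [|b [|c [|d [|e [|q [|]]]]]]] //= _.
  by rewrite mulr1 -[RHS]addrA -opprD.
have := sum_balance_ge0 chiP.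
rewrite (eq_bigr _ (fun t _ => E t)) !sumrB -mulr_sumr card_uniq.
set A := \sum_(t | _) _; set B := \sum_(t | _) _ => AB.
have A_le : A <= pentagon_multiplier * #|T|%:R *
    #|[pred t : 5.-tuple T | tuple_ccw t]|%:R.
  rewrite -sum_tuple_ccw [leRHS](bigID (fun t : 6.-tuple T => uniq t)) /=.
  by rewrite lerDl sumr_ge0 // => t _; case: ifP.
have B_ge : - B <= square_bound * (#|T|%:R ^+ 6 - (#|T| ^_ 6)%:R).
  have := sum_tuple_square_ge0 chi.
  rewrite (bigID (fun t : 6.-tuple T => uniq t)) /= -/B.
  rewrite -card_uniq -card_all [X in _ * (X - _)](bigID (fun t : 6.-tuple T => uniq t)) /=.
  rewrite [X in _ * (X - _)]addrC addrK mulr_sumr => B0.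
  rewrite -subr_ge0 opprK addrC (le_trans B0) // lerD2l ler_sum // => t _.
  rewrite mulr1; case: t => -[|a [|b [|c [|d [|e [|q [|]]]]]]] //= _.
  exact: square_term_bounded.
lia.
Qed.

End CountingBound.

(** * Orientations of points in the plane *)

Section Orientation.
Context {R : realType}.
Local Notation point := 'rV[R]_2.
Implicit Types (a b c d p q : point).

Definition det3 a b c : R :=
  (b 0 0 - a 0 0) * (c 0 1 - a 0 1) - (b 0 1 - a 0 1) * (c 0 0 - a 0 0).

Definition left_turn a b c : bool := 0 < det3 a b c.

Lemma det3C a b c : det3 b a c = - det3 a b c.
Proof. by rewrite /det3; ring. Qed.

Lemma det3_rot a b c : det3 b c a = det3 a b c.
Proof. by rewrite /det3; ring. Qed.

Lemma det3_xx a b : det3 a a b = 0.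
Proof. by rewrite /det3; ring. Qed.

Lemma left_turn_rot a b c : left_turn b c a = left_turn a b c.
Proof. by rewrite /left_turn det3_rot. Qed.

Lemma left_turn_xx a b : left_turn a a b = false.
Proof. by rewrite /left_turn det3_xx ltxx. Qed.

Lemma left_turnC a b c : det3 a b c != 0 -> left_turn b a c = ~~ left_turn a b c.
Proof. by move=> abc; rewrite /left_turn det3C oppr_gt0 -leNgt lt_neqAle abc. Qed.

Lemma point_eqP a b : a 0 0 = b 0 0 -> a 0 1 = b 0 1 -> a = b.
Proof.
move=> e0 e1; apply/rowP => i; case: i => [[|[|//]] lti].
- by have -> : Ordinal lti = 0 by apply: val_inj.
- by have -> : Ordinal lti = 1 by apply: val_inj.
Qed.

Lemma det3_eq0_line a b c : a != b -> det3 a b c = 0 -> line a (b - a) c.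
Proof.
move=> ab D.
have [e0|n0] := eqVneq (b 0 0) (a 0 0).
  have n1 : b 0 1 - a 0 1 != 0.
    by apply: contra ab => /eqP /subr0_eq e1; apply/eqP/point_eqP.
  have e2 : c 0 0 = a 0 0.
    move/eqP: D; rewrite /det3 e0 subrr mul0r sub0r oppr_eq0 mulf_eq0 (negbTE n1).
    by move=> /= /eqP /subr0_eq.
  exists ((c 0 1 - a 0 1) / (b 0 1 - a 0 1)) => //.
  by apply: point_eqP; rewrite !mxE ?e2 ?e0; field.
have m0 : b 0 0 - a 0 0 != 0 by rewrite subr_eq0.
exists ((c 0 0 - a 0 0) / (b 0 0 - a 0 0)) => //.
apply: point_eqP; rewrite !mxE; first by field.
have -> : c 0 1 = a 0 1 + (b 0 1 - a 0 1) * (c 0 0 - a 0 0) / (b 0 0 - a 0 0).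
  have {}D : (b 0 1 - a 0 1) * (c 0 0 - a 0 0) = (b 0 0 - a 0 0) * (c 0 1 - a 0 1).
    by apply/esym/subr0_eq.
  by rewrite D; field.
by field.
Qed.

Lemma placement_det3_neq0 (P : {fset point}) a b c : point_placement P ->
  a \in P -> b \in P -> c \in P -> uniq [:: a; b; c] -> det3 a b c != 0.
Proof.
move=> PP aP bP cP u; apply/eqP => D.
have ab : a != b by move: u; rewrite /= !inE negb_or; case: (a != b).
apply: (PP [fset x in [:: a; b; c]]%fset).
- apply/fsubsetP => x; rewrite !inE ?orbF => /or3P[] /eqP -> //.
- by rewrite card_fseq undup_id.
exists a, (b - a); split; first by rewrite subr_eq0 eq_sym.
move=> x /=; rewrite !inE ?orbF => /or3P[] /eqP ->.
- by exists 0 => //; rewrite scale0r addr0.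
- by exists 1 => //; rewrite scale1r addrC subrK.
- exact: det3_eq0_line.
Qed.

Lemma positive_combination (u v w x y z : R) : 0 < u -> 0 < v -> 0 < w ->
  u * x = v * y + w * z ->
  ((0 < y) && (0 < z) ==> (0 < x)) && ((y < 0) && (z < 0) ==> (x < 0)).
Proof.
move=> u0 v0 w0 E; apply/andP; split; apply/implyP => /andP[y0 z0].
- by rewrite -(pmulr_rgt0 x u0) E addr_gt0 // pmulr_rgt0.
- by rewrite -(pmulr_rlt0 x u0) E -oppr_gt0 opprD addr_gt0 // oppr_gt0 pmulr_rlt0.
Qed.

(* Projecting from [o] to a line turns points sorted by angle around [o] into
   points sorted by abscissa, for which this is the signotope axiom. *)
Lemma left_turn_one_change o a b c d :
  0 < det3 o a b -> 0 < det3 o a c -> 0 < det3 o a d ->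
  0 < det3 o b c -> 0 < det3 o b d -> 0 < det3 o c d ->
  det3 a b c != 0 -> det3 a b d != 0 -> det3 a c d != 0 -> det3 b c d != 0 ->
  at_most_one_change
    [:: left_turn a b c; left_turn a b d; left_turn a c d; left_turn b c d].
Proof.
move=> ab ac ad bc bd cd; rewrite /left_turn.
(* Three-term determinant relations, one for each three of the four signs in order: when the outer
   two agree, the middle one agrees with them. Hence no two changes. *)
have /andP[] : _ && _ := @positive_combination _ _ _ (det3 a b d) (det3 a c d)
  (det3 a b c) ac ab ad ltac:(rewrite /det3; ring).
have /andP[] : _ && _ := @positive_combination _ _ _ (det3 a b d) (det3 a b c)
  (det3 b c d) bc bd ab ltac:(rewrite /det3; ring).
have /andP[] : _ && _ := @positive_combination _ _ _ (det3 a c d) (det3 b c d)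
  (det3 a b c) bc ac cd ltac:(rewrite /det3; ring).
have /andP[] : _ && _ := @positive_combination _ _ _ (det3 a c d) (det3 b c d)
  (det3 a b d) bd ad cd ltac:(rewrite /det3; ring).
by case: (ltgtP 0 (det3 a b c)) => //; case: (ltgtP 0 (det3 a b d)) => //;
   case: (ltgtP 0 (det3 a c d)) => //; case: (ltgtP 0 (det3 b c d)).
Qed.

Definition lex_le p q : bool :=
  (p 0 0 < q 0 0) || ((p 0 0 == q 0 0) && (p 0 1 <= q 0 1)).

Lemma lex_le_total : total lex_le.
Proof.
move=> p q; rewrite /lex_le.
by case: (ltgtP (p 0 0) (q 0 0)) => //= _; exact: le_total.
Qed.

Lemma lex_le_trans : transitive lex_le.
Proof.
move=> q p r; rewrite /lex_le => /orP[pq|/andP[/eqP -> pq]] /orP[qr|/andP[/eqP <- qr]].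
- by rewrite (lt_trans pq qr).
- by rewrite pq.
- by rewrite qr.
- by rewrite eqxx (le_trans pq qr) orbT.
Qed.

(** All points lie to the right of [o] or on the upward vertical ray from it, so their directions
    fit in a half-open half-turn, where comparing angles is transitive. *)
Lemma left_turn_trans o a b c : lex_le o a -> lex_le o b -> lex_le o c ->
  left_turn o a b -> left_turn o b c -> left_turn o a c.
Proof.
rewrite /lex_le /left_turn /det3.
move: (a 0 0) (a 0 1) (b 0 0) (b 0 1) (c 0 0) (c 0 1) (o 0 0) (o 0 1).
move=> ax ay bx by' cx cy ox oy Ha Hb Hc.
have {Ha} : (0 < ax - ox) || (ax - ox == 0) && (0 <= ay - oy).
  by rewrite subr_gt0 subr_eq0 subr_ge0 [ax == _]eq_sym.
have {Hb} : (0 < bx - ox) || (bx - ox == 0) && (0 <= by' - oy).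
  by rewrite subr_gt0 subr_eq0 subr_ge0 [bx == _]eq_sym.
have {Hc} : (0 < cx - ox) || (cx - ox == 0) && (0 <= cy - oy).
  by rewrite subr_gt0 subr_eq0 subr_ge0 [cx == _]eq_sym.
move: (ax - ox) (ay - oy) (bx - ox) (by' - oy) (cx - ox) (cy - oy).
move=> {ax ay bx by' cx cy} ax ay bx by' cx cy.
move=> Hc Hb Ha ab bc.
(* If [b] were on the vertical line through [o], the left turn [bc] would force [c] to the left of
   [o]. *)
case/orP: Hb => [b0|/andP[/eqP b0 b1]]; last first.
  move: ab bc; rewrite b0; case/orP: Hc => [c0|/andP[/eqP -> _]] _; nra.
have E : bx * (ax * cy - ay * cx) =
  cx * (ax * by' - ay * bx) + ax * (bx * cy - by' * cx) by ring.
rewrite -(pmulr_rgt0 _ b0) E.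
have c_ge0 : 0 <= cx by case/orP: Hc => [/ltW|/andP[/eqP -> _]].
case/orP: Ha => [a0|/andP[/eqP a0 a1]].
  by rewrite ltr_wpDl ?mulr_ge0 ?mulr_gt0 // ltW.
move: ab; rewrite a0 mul0r sub0r; nra.
Qed.

End Orientation.

(** * Labelling six points by angle around a hull vertex *)

Definition colex_triples : seq (nat * nat * nat) :=
  [:: (1, 2, 3); (1, 2, 4); (1, 3, 4); (2, 3, 4); (1, 2, 5); (1, 3, 5);
      (2, 3, 5); (1, 4, 5); (2, 4, 5); (3, 4, 5)]%N.

(** An orientation is alternating, so its values on increasing triples determine it; those with
    label 0 are positive and the other ten are listed. *)
Lemma orientE (c : nat -> nat -> nat -> bool) i j k :
  (forall j k, (0 < j < k)%N -> (k < 6)%N -> c 0%N j k) ->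
  (forall i j k, (i < j < k)%N -> (k < 6)%N ->
     c j i k = ~~ c i j k) ->
  (forall i j k, c j k i = c i j k) -> (forall i j, c i i j = false) ->
  (i < 6)%N -> (j < 6)%N -> (k < 6)%N ->
  orient [seq c t.1.1 t.1.2 t.2 | t <- colex_triples] i j k = c i j k.
Proof.
move=> c0 cN cR cD i6 j6 k6; set s := map _ _.
have S i' j' k' : (i' < j' < k')%N -> (k' < 6)%N ->
    orient_sorted s i' j' k' = c i' j' k'.
  case: i' => [|i']; first by move=> jk k6'; rewrite c0.
  by move: i' j' k' => [|[|[|?]]] [|[|[|[|[|?]]]]] [|[|[|[|[|[|?]]]]]] //= ? ?; lia.
rewrite /orient.
case: (ltngtP i j) => [ij|ji|<-]; last by rewrite cD.
- case: (ltngtP j k) => [jk|kj|<-]; first by rewrite S ?ij.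
  + case: (ltngtP i k) => [ik|ki|<-] /=.
    * have ikj : (i < k < j)%N by rewrite ik.
      by rewrite S // -cN // (cR k i j).
    * by rewrite S ?ki // (cR k i j).
    * by rewrite (cR i i j) cD.
  + by rewrite ij /= -(cR i j j) cD.
- case: (ltngtP i k) => [ik|ki|<-] /=.
  + by rewrite S ?ji // (cN j i k) ?ji.
  + case: (ltngtP j k) => [jk|kj|<-] /=.
    * by rewrite S ?jk // cR.
    * have kji : (k < j < i)%N by rewrite kj.
      by rewrite S // -cN // cR.
    * by rewrite -(cR i j j) cD.
  + by rewrite ji ?ltnn /= (cR i i j) cD.
Qed.

Section PointSets.
Context {R : realType}.
Local Notation point := 'rV[R]_2.
Implicit Types (P Q : {fset point}).

Lemma left_turnC_in P a b c : point_placement P ->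
  a \in P -> b \in P -> c \in P -> uniq [:: a; b; c] ->
  left_turn b a c = ~~ left_turn a b c.
Proof.
by move=> PP aP bP cP u; apply: left_turnC; apply: placement_det3_neq0 PP _ _ _ _.
Qed.

(** With [o] lexicographically least, [left_turn_trans] allows the others to be sorted by angle
    around it. *)
Lemma angular_sort P (t : seq point) : point_placement P ->
  {subset t <= P} -> uniq t -> t != [::] ->
  exists o u, perm_eq (o :: u) t /\ pairwise (left_turn o) u.
Proof.
move=> PP tP tu t0.
have := sort_sorted lex_le_total t.
have : perm_eq (sort lex_le t) t by rewrite perm_sort.
case: (sort lex_le t) => [/perm_size/esym/size0nil t00|o u pu /=].
  by rewrite t00 in t0.
move=> /(order_path_min lex_le_trans) /allP ou.
have uP : {subset o :: u <= P} by move=> x; rewrite (perm_mem pu) => /tP.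
have oP := uP o (mem_head _ _).
have {}tu : uniq (o :: u) by rewrite (perm_uniq pu).
(* Sorting needs a total relation, so equality is added here and removed at the end by
   uniqueness. *)
pose r x y := (x == y) || left_turn o x y.
have dist x y : x \in u -> y \in u -> x != y -> uniq [:: o; x; y].
  move=> xu yu xy; rewrite /= !inE xy !andbT negb_or.
  by apply/andP; split; apply: contraTneq tu => ->; rewrite /= ?xu ?yu.
have uP' x : x \in u -> x \in P by move=> xu; apply: uP; rewrite inE xu orbT.
have r_total : {in u &, total r}.
  move=> x y xu yu; rewrite /r; case: eqVneq => //= xy.
  rewrite -(left_turn_rot o x y) -(left_turn_rot o y x).
  have u3 : uniq [:: x; y; o] by rewrite -(rot_uniq 2) dist.
  by rewrite (left_turnC_in PP (uP' _ xu) (uP' _ yu) oP u3) orbN.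
have r_trans : {in u & &, transitive r}.
  move=> y x z yu xu zu; rewrite /r => /predU1P[-> //|xy] /predU1P[<-|yz].
    by rewrite xy orbT.
  by rewrite (left_turn_trans (ou _ xu) (ou _ yu) (ou _ zu) xy yz) orbT.
exists o, (sort r u); split.
  by rewrite -(permPr pu) perm_cons perm_sort.
have uu : uniq (sort r u) by rewrite sort_uniq; case/andP: tu.
have : pairwise r (sort r u).
  have us : all [in u] (sort r u) by apply/allP => x; rewrite mem_sort.
  rewrite -(sorted_pairwise_in r_trans us); apply: (sort_sorted_in r_total).
  exact/allP.
rewrite uniq_pairwise in uu => /(conj uu)/andP; rewrite -pairwise_relI.
by apply: sub_pairwise => x y /andP[/negbTE xy]; rewrite /r xy.
Qed.

Lemma left_turn_sign_pattern P : point_placement P ->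
  sign_pattern_condition
    (fun x y z : P => left_turn (val x) (val y) (val z)).
Proof.
move=> PP t ut.
pose ts := map_tuple (val : P -> point) t.
have tsP : {subset (ts : seq point) <= P} by move=> x /mapP[y _ ->]; exact: valP.
have uts : uniq ts by rewrite map_inj_uniq //; exact: val_inj.
have ts0 : (ts : seq point) != [::] by rewrite -size_eq0 size_tuple.
have [z0 [u [pu ou]]] := angular_sort PP tsP uts ts0.
pose v i := nth z0 (z0 :: u) i.
have sv : size (z0 :: u) = 6%N by rewrite (perm_size pu) size_tuple.
have uv : uniq (z0 :: u) by rewrite (perm_uniq pu).
have vP i : (i < 6)%N -> v i \in P.
  by move=> i6; apply: tsP; rewrite -(perm_mem pu) mem_nth ?sv.
have v_uniq i j k : (i < j < k)%N -> (k < 6)%N -> uniq [:: v i; v j; v k].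
  move=> /andP[ij jk] k6; have j6 := ltn_trans jk k6; have i6 := ltn_trans ij j6.
  rewrite /= !inE /v !nth_uniq ?sv // negb_or.
  by rewrite !ltn_eqF // (ltn_trans ij jk).
have v_neq0 i j k : (i < j < k)%N -> (k < 6)%N -> det3 (v i) (v j) (v k) != 0.
  move=> ijk k6; have /andP[ij jk] := ijk.
  have j6 := ltn_trans jk k6; have i6 := ltn_trans ij j6.
  by apply: placement_det3_neq0 PP (vP _ _) (vP _ _) (vP _ _) (v_uniq _ _ _ ijk k6).
have v_sorted j k : (0 < j < k)%N -> (k < 6)%N -> left_turn (v 0%N) (v j) (v k).
  case: j k => [|j] [|k] // jk k6; have su : size u = 5%N by case: sv.
  move/(pairwiseP z0): ou; apply; rewrite ?inE ?su //.
  exact: ltn_trans (k6 : (k < 5)%N).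
have [p Ep] := tuple_permP pu.
pose c i j k := left_turn (v i) (v j) (v k).
exists p, [seq c t.1.1 t.1.2 t.2 | t <- colex_triples].
have cE i j k : (i < 6)%N -> (j < 6)%N -> (k < 6)%N ->
    orient [seq c t.1.1 t.1.2 t.2 | t <- colex_triples] i j k = c i j k.
  apply: orientE => //.
  - by move=> i' j' k' ijk k6; rewrite /c left_turnC ?v_neq0.
  - by move=> *; exact: left_turn_rot.
  - by move=> *; exact: left_turn_xx.
split=> //; last first.
  move=> i j k; rewrite cE // /c /v Ep.
  have nthE (l : 'I_6) :
    nth z0 [tuple tnth ts (p i0) | i0 < 6] l = val (tnth t (p l)).
    by rewrite -tnth_nth tnth_mktuple tnth_map.
  by rewrite !nthE.
(* The signotope axiom among labels 1, ..., 5 comes from projecting from the point labelled 0. *)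
have sig i j k l : (0 < i < j)%N -> (j < k < l)%N -> (l < 6)%N ->
    at_most_one_change
      [:: orient [seq c t.1.1 t.1.2 t.2 | t <- colex_triples] i j k;
          orient [seq c t.1.1 t.1.2 t.2 | t <- colex_triples] i j l;
          orient [seq c t.1.1 t.1.2 t.2 | t <- colex_triples] i k l;
          orient [seq c t.1.1 t.1.2 t.2 | t <- colex_triples] j k l].
  move=> /andP[i0 ij] /andP[jk kl] l6; rewrite !cE; try lia.
  apply: (left_turn_one_change (o := v 0%N)); (try by apply: v_sorted; lia);
    by apply: v_neq0; lia.
by apply/allP => q; rewrite !inE ?orbF => /or4P[| | |/orP[]] /eqP -> ; apply: sig.
Qed.

End PointSets.

(** * Convex pentagons *)

Section Pentagons.
Context {R : realType}.
Local Notation point := 'rV[R]_2.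
Implicit Types (P Q : {fset point}).

(** The closed half-plane [det3 b e x <= 0] is convex and contains [A], hence also its hull. *)
Lemma not_in_convex_hull (A : set point) (b e p : point) :
  (forall x, A x -> det3 b e x <= 0) -> 0 < det3 b e p -> ~ convex_hull A p.
Proof.
move=> Abe bep Ap.
have : [set x | det3 b e x <= 0] p; last by rewrite /= leNgt bep.
apply: (smallest_sub _ _ Ap) => // x y l /[!inE] /= xA yA.
change (det3 b e (l%:num *: x + (1 - l%:num) *: y) <= 0).
have -> : det3 b e (l%:num *: x + (1 - l%:num) *: y) =
  l%:num * det3 b e x + (1 - l%:num) * det3 b e y.
  by rewrite /det3 !mxE; ring.
have l1 : 0 <= 1 - l%:num by rewrite subr_ge0.
have l0 : 0 <= l%:num :> R by [].
nra.
Qed.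

Lemma ccw5_rot (a b c d e : point) :
  ccw5 left_turn a b c d e -> ccw5 left_turn b c d e a.
Proof.
rewrite /ccw5 => /and5P[abc abd abe acd /and5P[ace ade bcd bce /andP[bde cde]]].
rewrite (left_turn_rot a b c) (left_turn_rot a b d) (left_turn_rot a b e).
rewrite (left_turn_rot a c d) (left_turn_rot a c e) (left_turn_rot a d e).
by rewrite bcd bce bde cde abc abd abe acd ace ade.
Qed.

(** The line through the neighbours [b] and [e] separates [a] from the other vertices. *)
Lemma ccw5_not_in_hull (Q : {fset point}) (a b c d e : point) :
  Q = [fset x in [:: a; b; c; d; e]]%fset -> ccw5 left_turn a b c d e ->
  ~ convex_hull [set` (Q `\ a)%fset] a.
Proof.
move=> -> /and5P[abc abd abe acd /and5P[ace ade bcd bce /andP[bde cde]]].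
apply: (@not_in_convex_hull _ b e); last by rewrite det3_rot.
move=> x /=; rewrite !inE ?orbF => /andP[/negbTE ->] /= /or4P[] /eqP ->.
- by rewrite det3_rot det3_xx.
- by rewrite det3C -det3_rot oppr_le0 ltW.
- by rewrite det3C -det3_rot oppr_le0 ltW.
- by rewrite 2!det3_rot det3_xx.
Qed.

Lemma fset_seq_rot (n : nat) (s : seq point) :
  [fset x in s]%fset = [fset x in rot n s]%fset.
Proof.
apply/fsetP => x; apply/imfsetP/imfsetP => -[y ys ->]; exists y => //; move: ys;
  by rewrite /= mem_rot.
Qed.

Lemma ccw5_convex_position (a b c d e : point) :
  ccw5 left_turn a b c d e ->
  convex_position [fset x in [:: a; b; c; d; e]]%fset.
Proof.
move=> C1; have C2 := ccw5_rot C1; have C3 := ccw5_rot C2.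
have C4 := ccw5_rot C3; have C5 := ccw5_rot C4.
move=> p; rewrite !inE ?orbF => /or4P[| | |/orP[]] /eqP ->.
- exact: ccw5_not_in_hull C1.
- by apply: ccw5_not_in_hull C2; apply: (fset_seq_rot 1).
- by apply: ccw5_not_in_hull C3; apply: (fset_seq_rot 2).
- by apply: ccw5_not_in_hull C4; apply: (fset_seq_rot 3).
- by apply: ccw5_not_in_hull C5; apply: (fset_seq_rot 4).
Qed.

Definition pentagon_sets P : {set {set P}} :=
  finset (fun A : {set P} =>
    (#|A| == 5)%N && `[< convex_position [fsetval x in A]%fset >]).

Lemma convex_pentagonsE P : convex_pentagons P = #|pentagon_sets P|.
Proof.
pose g (A : {set P}) : {fset point} := [fsetval x in A]%fset.
have gE (A : {set P}) (x : P) : (val x \in g A) = (x \in A).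
  apply/imfsetP/idP => [[y /= yA /val_inj ->] //|xA]; by exists x.
have g_inj : injective g.
  by move=> A B AB; apply/setP => x; rewrite -!gE AB.
have card_g A : #|` g A| = #|A|.
  by rewrite card_imfset //= -?cardE //; exact: val_inj.
have -> : convex_pentagons P = #|` [fset g A | A in pentagon_sets P]%fset|.
  congr (#|` _|); apply/fsetP => Q; rewrite !inE /=.
  apply/andP/imfsetP => [[QP /andP[Q5 Qc]]|[A /=]].
    have QE : Q = g (finset (fun x : P => val x \in Q)).
      apply/fsetP => x; apply/idP/imfsetP => [xQ|[y /=]].
        have xP : x \in P by move: QP; rewrite fpowersetE => /fsubsetP; apply.
        by exists [` xP]%fset; rewrite //= inE.
      by rewrite inE => yQ ->.
    exists (finset (fun x : P => val x \in Q)) => //.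
    by rewrite inE -card_g -/(g _) -QE Q5 Qc.
  rewrite inE => /andP[A5 Ac] ->; split; last by rewrite card_g A5 Ac.
  by rewrite fpowersetE; apply/fsubsetP => x /imfsetP[y _ ->]; exact: valP.
by rewrite card_imfset //= -cardE.
Qed.

End Pentagons.

(** The head is the only entry related to all the others, so the two heads coincide. *)
Lemma pairwise_asym_perm_eq (T : eqType) (r : rel T) (s t : seq T) :
  (forall x y, r x y -> ~~ r y x) -> pairwise r s -> pairwise r t ->
  perm_eq s t -> s = t.
Proof.
move=> asym; elim: s t => [|x s IH] [|y t] //=; first by move=> _ _ /perm_size.
- by move=> _ _ /perm_size.
move=> /andP[/allP xs ps] /andP[/allP yt pt] st.
have [xy|xy] := eqVneq x y.
  by rewrite -xy perm_cons in st *; rewrite (IH t).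
have xt : x \in t.
  by have := mem_head x s; rewrite (perm_mem st) inE (negbTE xy).
have ys : y \in s.
  by have := mem_head y t; rewrite -(perm_mem st) inE eq_sym (negbTE xy).
by have := asym _ _ (xs _ ys); rewrite (yt _ xt).
Qed.

(** * Counterclockwise 5-tuples against pentagons *)

Section CountPentagons.
Context {R : realType}.
Local Notation point := 'rV[R]_2.

Lemma left_turn_asym (a b c : point) : left_turn a b c -> ~~ left_turn a c b.
Proof.
by move=> abc; rewrite /left_turn -leNgt det3C -det3_rot oppr_le0 ltW.
Qed.

Lemma card_ccw_le (P : {fset point})
  (chi := fun x y z : P => left_turn (val x) (val y) (val z)) :
  (#|[pred t : 5.-tuple P | tuple_ccw chi t]| <= 5 * convex_pentagons P)%N.
Proof.
have xx x y : chi x x y = false by rewrite /chi left_turn_xx.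
have rot x y z : chi y z x = chi x y z by rewrite /chi left_turn_rot.
have ccw_uniq (t : 5.-tuple P) : tuple_ccw chi t -> uniq t.
  case: t => -[|a [|b [|c [|d [|e [|]]]]]] //= _.
  rewrite /ccw5 => /and5P[abc abd abe acd /and5P[ace ade bcd bce /andP[bde cde]]].
  rewrite !inE.
  have neq x y z : chi x y z ->
      [/\ x == y = false, x == z = false & y == z = false].
    move=> h; split; apply/negP => /eqP e'; move: h; rewrite e' ?xx //.
    - by rewrite rot xx.
    - by rewrite -rot xx.
  have [-> -> ->] := neq _ _ _ abc; have [-> -> ->] := neq _ _ _ ade.
  by have [-> -> _] := neq _ _ _ bde; have [-> -> _] := neq _ _ _ cde.
(* Pairs of a pentagon and one of its vertices: five per pentagon. *)
pose E : {set {set P} * P} :=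
  finset (fun Ax : {set P} * P => (Ax.1 \in pentagon_sets P) && (Ax.2 \in Ax.1)).
have -> : (5 * convex_pentagons P)%N = #|E|.
  rewrite convex_pentagonsE -[RHS]sum1_card.
  rewrite (eq_bigl (fun Ax : {set P} * P =>
    (Ax.1 \in pentagon_sets P) && (Ax.2 \in Ax.1))); last by move=> ?; rewrite inE.
  rewrite -(pair_big_dep (mem (pentagon_sets P)) (fun A x => x \in A) (fun _ _ => 1%N)) /=.
  rewrite (eq_bigr (fun _ => 5%N)); last first.
    by move=> A; rewrite inE sum1_card => /andP[/eqP].
  by rewrite sum_nat_const mulnC.
pose f (t : 5.-tuple P) : {set P} * P := (finset (fun x => x \in t), thead t).
(* The first vertex determines the counterclockwise labelling, so a pentagon
   has at most five of them. *)
have f_inj : {in [pred t : 5.-tuple P | tuple_ccw chi t] &, injective f}.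
  move=> t t'; rewrite !inE => ct ct' [] /setP tt'.
  have : perm_eq t t'.
    apply: uniq_perm; rewrite ?ccw_uniq // => x.
    by have := tt' x; rewrite !inE.
  move=> ptt' hd; apply: val_inj => /=.
  move: t t' ct ct' ptt' hd {tt'} => [[|a [|b [|c [|d [|e [|]]]]]] //= ?].
  move=> [[|a' [|b' [|c' [|d' [|e' [|]]]]]] //= ?].
  rewrite /ccw5 => /and5P[abc abd abe acd /and5P[ace ade _ _ _]].
  move=> /and5P[abc' abd' abe' acd' /and5P[ace' ade' _ _ _]] + aa'.
  have {}aa' : a = a' := aa'; subst a'.
  rewrite perm_cons => pe; congr cons.
  (* In both tuples the remaining four vertices appear in angular order around [a]. *)
  apply: (@pairwise_asym_perm_eq _ (chi a)) pe => /=.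
  - by move=> x y; apply: left_turn_asym.
  - by rewrite abc abd abe acd ace ade.
  - by rewrite abc' abd' abe' acd' ace' ade'.
rewrite -(card_in_imset f_inj); apply: subset_leq_card.
apply/fintype.subsetP => _ /imsetP[t ct ->]; rewrite inE in ct.
have ut := ccw_uniq _ ct; rewrite inE /= !inE.
apply/andP; split; last by rewrite (tuple_eta t) mem_head.
apply/andP; split.
  by rewrite cardsE (card_uniqP ut) size_tuple.
apply/asboolP.
have -> : [fsetval x in finset (fun x => x \in t)]%fset =
  [fset x in [seq val x | x <- t]]%fset.
  apply/fsetP => x; apply/imfsetP/idP => [[y /=]|].
    by rewrite !inE => yt ->; apply: map_f.
  by rewrite !inE => /mapP[y yt ->]; exists y; rewrite //= inE.
case: t ct {ut} => -[|a [|b [|c [|d [|e [|]]]]]] //= _.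
exact: ccw5_convex_position.
Qed.

End CountPentagons.

(** * The minimum number of pentagons *)

(** A 6-tuple with a repetition has equal entries at one of 15 pairs of positions. *)
Lemma ffact6_lower_bound (n : nat) : (n ^ 6 <= n ^_ 6 + 15 * n ^ 5)%N.
Proof.
have [n6|n6] := leqP n 15.
  by rewrite (leq_trans _ (leq_addl _ _)) // expnS leq_mul.
rewrite -(subnK (ltnW n6)); set m := (n - 15)%N.
rewrite !ffactnSr ffactn0 !mul1n subn0 -!addnBA //.
rewrite /subn /= !expnS !expn0; nia.
Qed.

Lemma ffact_le_exp (n k : nat) : (n ^_ k <= n ^ k)%N.
Proof.
elim: k => // k IH; rewrite ffactnSr expnSr leq_mul // leq_subr //.
Qed.

Section MinimumPentagons.
Context {R : realType}.
Local Notation point := 'rV[R]_2.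
Implicit Types (P Q : {fset point}).

Lemma Z_natr (n : nat) : n%:R = Z.of_nat n :> Z.
Proof. by elim: n => // n IH; rewrite -natr1 IH; lia. Qed.

(** The coefficients are 525, 5 * 276000 and 15 * 66000, all divided by 15. *)
Lemma convex_pentagons_lower_bound P : point_placement P ->
  (35 * #|` P| ^ 5 <= 92 * 1000 * convex_pentagons P + 66 * 1000 * #|` P| ^ 4)%N.
Proof.
move=> PP; have [->|n0] := posnP #|` P|; first by rewrite exp0n ?muln0.
have := ccw_count_lower_bound (left_turn_sign_pattern PP).
have := card_ccw_le P; have := ffact6_lower_bound #|` P|.
rewrite -!cardfE /density_numerator /square_bound /pentagon_multiplier -natrX !Z_natr.
set h := #|[pred t | _]|; move: n0 h.
move: #|` P| (convex_pentagons P) => n c n0 h Hf hc Hz.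
have {}hc : (n * h <= 5 * (n * c))%N by rewrite mulnCA leq_mul.
(* Here 66000 = 525 + 225 * 291 is [density_numerator + square_bound]. *)
have {}Hz : (66 * 1000 * n ^_ 6 <= 276 * 1000 * (n * h) + 225 * 291 * n ^ 6)%N by lia.
rewrite -(leq_pmul2l n0).
have -> : (n * (35 * n ^ 5) = 35 * n ^ 6)%N by rewrite mulnCA -expnS.
have -> : (n * (92 * 1000 * c + 66 * 1000 * n ^ 4) =
    92 * 1000 * (n * c) + 66 * 1000 * n ^ 5)%N.
  by rewrite mulnDr mulnCA [(n * (66 * 1000 * _))%N]mulnCA -expnS.
move: Hf hc Hz; move: (n ^_ 6)%N (n ^ 6)%N (n ^ 5)%N (n * c)%N (n * h)%N.
by move=> *; lia.
Qed.

(** * The minimum and the monotonicity of its density *)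

Lemma pentagon_count_mu5 n : pentagon_count R n (mu5 R n).
Proof. by rewrite /mu5; case: ex_minnP => m /asboolP. Qed.

Lemma mu5_le P : point_placement P -> (mu5 R #|` P| <= convex_pentagons P)%N.
Proof.
move=> PP; rewrite /mu5; case: ex_minnP => m _; apply.
by apply/asboolP; exists P.
Qed.

Lemma convex_pentagons_le_bin P : (convex_pentagons P <= 'C(#|` P|, 5))%N.
Proof.
rewrite convex_pentagonsE cardfE -card_draws; apply: subset_leq_card.
by apply/fintype.subsetP => A; rewrite !inE => /andP[].
Qed.

Lemma mu5_le_bin n : (mu5 R n <= 'C(n, 5))%N.
Proof.
by have [P [_ <- <-]] := pentagon_count_mu5 n; exact: convex_pentagons_le_bin.
Qed.

Lemma point_placement_sub P Q : (Q `<=` P)%fset -> point_placement P ->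
  point_placement Q.
Proof. by move=> QP PP T TQ; apply: PP; exact: fsubset_trans TQ QP. Qed.

(** A pentagon survives the deletion of exactly the points outside it. *)
Lemma sum_convex_pentagons_remove P :
  (\sum_(p <- P) convex_pentagons (P `\ p)%fset =
   (#|` P| - 5) * convex_pentagons P)%N.
Proof.
pose F := [fset Q in fpowerset P |
  (#|` Q| == 5%N) && `[< convex_position Q >]]%fset.
have E p : p \in P ->
    convex_pentagons (P `\ p)%fset = (\sum_(Q <- F) (p \notin Q))%N.
  move=> pP; rewrite -big_mkcond /= sum1_count -size_filter.
  rewrite /convex_pentagons; apply: perm_size; apply: uniq_perm.
  - exact: fset_uniq.
  - exact/filter_uniq/fset_uniq.
  move=> Q; rewrite mem_filter !inE !fpowersetE fsubsetD1.
  by case: (Q `<=` P)%fset; rewrite ?andbF //= andbC.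
have E2 Q : Q \in F -> (\sum_(p <- P) (p \notin Q) = #|` P| - 5)%N.
  rewrite !inE fpowersetE => /andP[QP /andP[/eqP Q5 _]].
  rewrite -big_mkcond /= sum1_count -size_filter.
  have -> : (#|` P| - 5)%N = #|` (P `\` Q)%fset|.
    by rewrite cardfsD (fsetIidPr QP) Q5.
  apply: perm_size; apply: uniq_perm.
  - exact/filter_uniq/fset_uniq.
  - exact: fset_uniq.
  by move=> p; rewrite mem_filter in_fsetD.
rewrite big_seq (eq_bigr _ E) -big_seq exchange_big /= big_seq (eq_bigr _ E2).
by rewrite -big_seq big_const_seq count_predT iter_addn_0.
Qed.

(** Delete each point in turn from an optimal placement of [n.+1] points; what remains has at least
    [mu5 R n] pentagons. *)
Lemma mu5_succ n : (n.+1 * mu5 R n <= (n - 4) * mu5 R n.+1)%N.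
Proof.
have [P [PP Pn <-]] := pentagon_count_mu5 n.+1.
rewrite -[(n - 4)%N]/(n.+1 - 5)%N -Pn -sum_convex_pentagons_remove.
have -> : (#|` P| * mu5 R n = \sum_(p <- P) mu5 R n)%N.
  by rewrite big_const_seq count_predT iter_addn_0 mulnC.
rewrite big_seq [leqRHS]big_seq; apply: leq_sum => p pP.
have -> : n = #|` (P `\ p)%fset|.
  by move: Pn; rewrite (cardfsD1 p) pP => -[].
by apply: mu5_le; apply: point_placement_sub PP; exact: fsubD1set.
Qed.

Lemma pentagon_density_succ n :
  pentagon_density R n <= pentagon_density R n.+1.
Proof.
rewrite /pentagon_density; have [n5|n5] := ltnP n 5.
  by rewrite (bin_small n5) invr0 mulr0 mulr_ge0 // ?invr_ge0 ler0n.
have b0 : (0 : R) < 'C(n, 5)%:R by rewrite ltr0n bin_gt0.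
have b1 : (0 : R) < 'C(n.+1, 5)%:R by rewrite ltr0n bin_gt0 leqW.
rewrite ler_pdivrMr // mulrAC ler_pdivlMr // -!natrM ler_nat.
(* This factor lets [E] cancel the binomials, leaving [mu5_succ]. *)
rewrite -(@leq_pmul2l (n.+1 * (n - 4))) ?muln_gt0 ?subn_gt0 //.
have E : (n.+1 * 'C(n, 5) = (n - 4) * 'C(n.+1, 5))%N.
  by rewrite -(mul_bin_down n.+1 5).
rewrite mulnACA -E [leqRHS](_ : _ =
  ((n - 4) * mu5 R n.+1 * (n.+1 * 'C(n, 5)))%N); last by ring.
by rewrite leq_mul2r mu5_succ orbT.
Qed.

Lemma pentagon_density_le1 n : pentagon_density R n <= 1.
Proof.
rewrite /pentagon_density; have [n5|n5] := ltnP n 5.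
  by rewrite (bin_small n5) invr0 mulr0.
by rewrite ler_pdivrMr ?ltr0n ?bin_gt0 // mul1r ler_nat mu5_le_bin.
Qed.

(** [161 / 72] is a continued fraction convergent: 161^2 = 5 * 72^2 + 1. The lower bound makes 5
    sqrt 5 - 11 nonnegative. *)
Lemma sqrt5_bounds : 11 / 5 <= Num.sqrt (5 : R) <= 161 / 72.
Proof.
have s0 : 0 <= Num.sqrt 5 :> R by exact: sqrtr_ge0.
have s2 : Num.sqrt 5 ^+ 2 = 5 :> R by rewrite sqr_sqrtr.
apply/andP; split.
- rewrite leNgt; apply/negP => h; nra.
- rewrite leNgt; apply/negP => h; nra.
Qed.

Lemma mu5_lower_bound n : (200 * 1000 < n)%N ->
  (5 * Num.sqrt 5 - 11) / 480 * n%:R ^+ 5 <= (mu5 R n)%:R :> R.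
Proof.
move=> n_large; have [P [PP Pn <-]] := pentagon_count_mu5 n.
have := convex_pentagons_lower_bound PP; rewrite Pn.
rewrite -(ler_nat R) natrD (natrM _ 35) (natrM _ (66 * 1000)) !natrX !natrM.
move: (convex_pentagons P)%:R => c.
have {n_large} : 200 * 1000 <= n%:R :> R by rewrite -natrM ler_nat ltnW.
move: n%:R => x x_large bound.
have x4 : 0 <= x ^+ 4 by apply: exprn_ge0; lra.
have x5 : 200 * 1000 * x ^+ 4 <= x ^+ 5 by rewrite [leRHS]exprS ler_wpM2r.
have x5_ge0 : 0 <= x ^+ 5 by apply: exprn_ge0; lra.
have /andP[_ s5] := sqrt5_bounds.
(* The rational constant is 13/34560, below 35/92000; the gap times [x ^+ 5] exceeds the error
   (66/92) [x ^+ 4] once [x] passes about 168000, hence the threshold. *)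
apply: (@le_trans _ _ ((5 * (161 / 72) - 11) / 480 * x ^+ 5)).
  by apply: ler_wpM2r; [exact: x5_ge0|lra].
lra.
Qed.

End MinimumPentagons.

Theorem theorem1 (R : realType) :
  (exists C : nat, forall n : nat, (C < n)%N ->
     (5 * Num.sqrt 5 - 11) / 480 * n%:R ^+ 5 <= (mu5 R n)%:R :> R) /\
  (cvgn (pentagon_density R) /\ (5 * Num.sqrt 5 - 11) / 4 <= c5 R).
Proof.
split; first by exists (200 * 1000)%N; exact: mu5_lower_bound.
have incr : nondecreasing_seq (pentagon_density R).
  by apply/nondecreasing_seqP; exact: pentagon_density_succ.
have cvg_density : cvgn (pentagon_density R).
  apply: nondecreasing_is_cvgn => //; exists 1 => _ [n _ <-].
  exact: pentagon_density_le1.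
(* A nondecreasing convergent sequence stays below its limit, so a single term past the threshold
   bounds [c5]. *)
split=> //; have [n n_large] : exists n, (200 * 1000 < n)%N.
  by exists (200 * 1000).+1.
apply: le_trans (nondecreasing_cvgn_le incr cvg_density n).
have bin_pos : (0 : R) < 'C(n, 5)%:R.
  rewrite ltr0n bin_gt0; apply: leq_trans (ltnW n_large).
  by rewrite -[5%N]muln1 leq_mul.
rewrite /pentagon_density ler_pdivlMr //.
apply: le_trans (mu5_lower_bound n_large).
(* Isolates [n ^ 5 / 120], which is at least ['C(n, 5)]. *)
have -> : (5 * Num.sqrt 5 - 11) / 480 * n%:R ^+ 5 =
    (5 * Num.sqrt 5 - 11) / 4 * (n%:R ^+ 5 / 120) :> R by field.
have /andP[s5 _] := @sqrt5_bounds R.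
apply: ler_wpM2l; first by rewrite divr_ge0 //; lra.
rewrite ler_pdivlMr // -natrX -(natrM _ _ 120) ler_nat.
by rewrite -[120%N]/(5`!) bin_ffact ffact_le_exp.
Qed.
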